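(* Let $n\ge 2$ and let $D\subsetneq\mathbb{R}^n$ be a proper subdomain. For any two points $x,y\in D$, $$2\log\left(1+\frac{d(D)|x-y|}{2\sqrt{\eta_D(x)\eta_D(y)}}\right)\le i_D^*(x,y)\le 2\log\left(1+\frac{d(D)|x-y|}{2\sqrt{\eta_D(x)\eta_D(y)}}+\frac{d(D)^2|x-y|^2}{2\sqrt{\eta_D(x)\eta_D(y)}\,\bigl(\sqrt{\eta_D(x)}+\sqrt{\eta_D(y)}\bigr)^2}\right).$$ In particular, for every $x\in D$, $$\lim_{y\to x,\ y\ne x}\frac{i_D^*(x,y)}{|x-y|}=\frac{d(D)}{\eta_D(x)},$$ and $m_D$ is the inner metric of $i_D^*$.
   Context: A domain is a nonempty open connected set. For a proper subdomain $D\subset\mathbb{R}^n$ and $z\in D$, $\delta_D(z)=\inf\{|z-\xi|:\xi\in\partial D\}$ is the Euclidean distance from $z$ to $\partial D$, $d(D)$ is the Euclidean diameter of $D$ (infinite if $D$ is unbounded), and, when $D$ is bounded, $\eta_D(z)=\delta_D(z)\,(d(D)-\delta_D(z))$. Define $$i_D^*(x,y)=2\log\frac{\eta_D(x)+\eta_D(y)+d(D)\,|x-y|}{2\sqrt{\eta_D(x)\,\eta_D(y)}},\qquad m_D(x,y)=\inf_{\gamma\in\Gamma_{xy}}\int_\gamma\frac{d(D)}{\eta_D(z)}\,|dz|,$$ where $\Gamma_{xy}$ is the family of all rectifiable paths in $D$ joining $x$ to $y$. If $D$ is unbounded, all expressions are read with $\eta_D(z)/d(D)$ replaced by $\delta_D(z)$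 (equivalently, with $\eta_D$ replaced by $\delta_D$ and $d(D)$ replaced by $1$). The function $i_D^*$ is a metric on $D$. The inner metric of a metric $\rho$ on $D$ is $\hat\rho(x,y)=\inf_\gamma \ell_\rho(\gamma)$, the infimum over all rectifiable paths $\gamma$ in $D$ joining $x$ to $y$, where $\ell_\rho(\gamma)=\sup\sum_{k}\rho(\gamma(t_{k-1}),\gamma(t_k))$ (supremum over all partitions of the parameter interval) is the $\rho$-length of $\gamma$. *)

(* Defs.v *)
From HB Require Import structures.
From mathcomp Require Import all_boot all_order all_algebra.
From mathcomp Require Import all_classical all_reals all_analysis.

Set Implicit Arguments.
Unset Strict Implicit.
Unset Printing Implicit Defensive.

Import Order.TTheory GRing.Theory Num.Theory.
Import numFieldNormedType.Exports.

Local Open Scope classical_set_scope.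
Local Open Scope ring_scope.

(* The library norm of 'rV[R]_n is the maximum norm. It induces the usual
   topology of R^n, so [open], [connected], limits and continuity are the
   library's; all lengths and distances below are Euclidean. *)
Definition euclid_dist (R : realType) (n : nat) (x y : 'rV[R]_n) : R :=
  Num.sqrt (\sum_(i < n) (x 0 i - y 0 i) ^+ 2).

Definition top_boundary (T : topologicalType) (D : set T) : set T :=
  closure D `\` interior D.

Definition domain (T : topologicalType) (D : set T) : Prop :=
  [/\ D !=set0, open D & connected D].

Definition euclid_diam (R : realType) (n : nat) (D : set 'rV[R]_n) : \bar R :=
  ereal_sup [set r | exists x y, [/\ D x, D y & r = (euclid_dist x y)%:E]].

(* [inf] is the infimum of R; the boundary is nonempty for D a proper domain. *)
Definition delta_dom (R : realType) (n : nat) (D : set 'rV[R]_n) (z : 'rV[R]_n)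
    : R :=
  inf [set euclid_dist z xi | xi in top_boundary D].

(* Convention for unbounded D (euclid_diam D = +oo): eta_D is delta_D, and the
   factor d(D) is 1. The case euclid_diam D = -oo is that of the empty set. *)
Definition diam_factor (R : realType) (n : nat) (D : set 'rV[R]_n) : R :=
  if euclid_diam D is d%:E then d else 1.

Definition eta_dom (R : realType) (n : nat) (D : set 'rV[R]_n) (z : 'rV[R]_n)
    : R :=
  if euclid_diam D is d%:E then delta_dom D z * (d - delta_dom D z)
  else delta_dom D z.

Definition i_star (R : realType) (n : nat) (D : set 'rV[R]_n)
    (x y : 'rV[R]_n) : R :=
  2 * ln ((eta_dom D x + eta_dom D y + diam_factor D * euclid_dist x y)
          / (2 * Num.sqrt (eta_dom D x * eta_dom D y))).

(* A path is a function on R of which only the restriction to the parameter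
   interval [a, b] matters. *)
Definition metric_length (R : realType) (T : Type) (rho : T -> T -> R)
    (a b : R) (g : R -> T) : \bar R :=
  ereal_sup [set (\sum_(0 <= k < size s)
                   rho (g (nth b (a :: s) k)) (g (nth b (a :: s) k.+1)))%:E
            | s in [set s | itv_partition a b s]].

Definition rectifiable_path (R : realType) (n : nat)
    (a b : R) (g : R -> 'rV[R]_n) : Prop :=
  [/\ a < b, {within `[a, b], continuous g}
    & (metric_length (@euclid_dist R n) a b g < +oo)%E].

Definition rectifiable_path_in (R : realType) (n : nat) (D : set 'rV[R]_n)
    (x y : 'rV[R]_n) (a b : R) (g : R -> 'rV[R]_n) : Prop :=
  [/\ rectifiable_path a b g, g @` `[a, b] `<=` D, g a = x & g b = y].

(* The arc-length parametrization g0 : [0, L] -> R^n, determined by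
   g0 (length of g on [a, t]) = g t for t in [a, b]; the choice of t is
   immaterial because g is constant between two parameters with the same
   arc length. *)
Definition arclength_param (R : realType) (n : nat) (a b : R)
    (g : R -> 'rV[R]_n) (u : R) : 'rV[R]_n :=
  g (xget a [set t | t \in `[a, b]
                     /\ metric_length (@euclid_dist R n) a t g = u%:E]).

(* The integral of w |dz| over g, i.e. the integral over [0, L] of w along the
   arc-length parametrization, L being the Euclidean length of g. *)
Definition line_integral (R : realType) (n : nat) (w : 'rV[R]_n -> R)
    (a b : R) (g : R -> 'rV[R]_n) : \bar R :=
  (\int[@lebesgue_measure R]_(u in
      `[0%R, fine (metric_length (@euclid_dist R n) a b g)])
    (w (arclength_param a b g u))%:E)%E.

Definition m_metric (R : realType) (n : nat) (D : set 'rV[R]_n)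
    (x y : 'rV[R]_n) : \bar R :=
  ereal_inf [set l | exists a b g, rectifiable_path_in D x y a b g
    /\ l = line_integral (fun z => diam_factor D / eta_dom D z) a b g].

Definition inner_metric (R : realType) (n : nat) (D : set 'rV[R]_n)
    (rho : 'rV[R]_n -> 'rV[R]_n -> R) (x y : 'rV[R]_n) : \bar R :=
  ereal_inf [set l | exists a b g, rectifiable_path_in D x y a b g
    /\ l = metric_length rho a b g].

(* Main.v *)
Require Import Defs.
From mathcomp Require Import all_boot all_order all_algebra.
From mathcomp Require Import all_classical all_reals all_analysis.
From mathcomp Require Import measurable_realfun.
From mathcomp Require Import ring lra.

Set Implicit Arguments.
Unset Strict Implicit.
Unset Printing Implicit Defensive.
Import Order.TTheory GRing.Theory Num.Theory.
Import numFieldNormedType.Exports.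
Local Open Scope classical_set_scope.
Local Open Scope ring_scope.

(** The proof rests on two properties of the function eta: it is positive on the
    domain D, and it is Lipschitz with constant d, where d = d(D) for bounded D,
    and d = 1, eta = delta otherwise ([diam_factor_eta_dom]). Both follow from the fact that the distance delta
    to the boundary is 1-Lipschitz and, for bounded D, satisfies
    2 delta <= d(D), because the ball of radius delta(x) around x lies in D.

    Put p = eta(x), q = eta(y) and t = d |x - y|, so that |p - q| <= t. The lower
    bound is the inequality p + q >= 2 sqrt (p q); the upper bound writes the
    defect p + q - 2 sqrt (p q) as (p - q)^2 / (sqrt p + sqrt q)^2 and uses
    |p - q| <= t ([mean_ratio_ge], [mean_ratio_le]). As y and z tend to x, both
    bounds for i_star(y, z) become d |y - z| / eta(x) up to a factor that tends
    to 1, uniformly in y and z. This is the statement that d / eta is the length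
    density of i_star ([i_star_length_density]); taking y = x gives the limit.

    The equality of m_D with the inner metric holds path by path: for a
    rectifiable path in D, the i_star-length equals the line integral of d / eta
    ([line_integral_metric_length]). On a short piece of the path, both
    quantities differ from the Euclidean length of the piece times d / eta by at
    most a small multiple of that length. Both quantities are additive under
    subdivision, the i_star-length by the triangle inequality
    ([i_star_triangle]), which in turn comes from |p - q| <= t. A Cousin-type
    argument ([interval_additive_ind]) makes the estimate global. That the
    integral over an arc-length interval sees only the corresponding piece of
    the path requires the arc length to be continuous
    ([arclength_continuous]). *)

(** * Lengths of paths for an arbitrary distance function *)

(** The recursive form of the partition sums in [metric_length]: it has no
    default value for [nth], so it splits along concatenations without any
    index arithmetic. *)
Fixpoint chain_length (R : realType) (T : Type) (rho : T -> T -> R)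
    (g : R -> T) (a : R) (s : seq R) : R :=
  if s is x :: s' then rho (g a) (g x) + chain_length rho g x s' else 0.

Lemma chain_lengthE (R : realType) (T : Type) (rho : T -> T -> R)
    (g : R -> T) (b a : R) (s : seq R) :
  \sum_(0 <= k < size s)
     rho (g (nth b (a :: s) k)) (g (nth b (a :: s) k.+1))
  = chain_length rho g a s.
Proof.
elim: s a => [|x s IH] a /=; first by rewrite big_nil.
by rewrite big_nat_recl//= -IH.
Qed.

Lemma metric_lengthE (R : realType) (T : Type) (rho : T -> T -> R)
    (g : R -> T) (a b : R) :
  metric_length rho a b g =
  ereal_sup [set (chain_length rho g a s)%:E
            | s in [set s | itv_partition a b s]].
Proof.
rewrite /metric_length; congr ereal_sup; apply: eq_imagel => s _.
by congr EFin; exact: chain_lengthE.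
Qed.

Lemma chain_length_cat (R : realType) (T : Type) (rho : T -> T -> R)
    (g : R -> T) (a : R) (s t : seq R) :
  chain_length rho g a (s ++ t)
  = chain_length rho g a s + chain_length rho g (last a s) t.
Proof. by elim: s a => [|x s IH] a /=; rewrite ?add0r// IH addrA. Qed.

Lemma chain_length_ub (R : realType) (T : Type) (rho : T -> T -> R)
    (g : R -> T) (a b : R) (s : seq R) : itv_partition a b s ->
  ((chain_length rho g a s)%:E <= metric_length rho a b g)%E.
Proof.
by move=> sab; rewrite metric_lengthE; apply: ereal_sup_ubound; exists s.
Qed.

Lemma metric_length_le (R : realType) (T : Type) (rho : T -> T -> R)
    (g : R -> T) (a b : R) (l : \bar R) :
  (forall s, itv_partition a b s -> ((chain_length rho g a s)%:E <= l)%E) ->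
  (metric_length rho a b g <= l)%E.
Proof.
by move=> H; rewrite metric_lengthE; apply: ge_ereal_sup => _ [s sab <-]; exact: H.
Qed.

Lemma metric_lengthxx (R : realType) (T : Type) (rho : T -> T -> R)
    (g : R -> T) (a : R) : metric_length rho a a g = 0%E.
Proof.
apply/eqP; rewrite eq_le; apply/andP; split.
  by apply: metric_length_le => s /itv_partitionxx ->.
by apply: (@chain_length_ub _ _ _ _ _ _ [::]); split => //=.
Qed.

Lemma metric_length_ge_dist (R : realType) (T : Type) (rho : T -> T -> R)
    (g : R -> T) (a b : R) : a < b ->
  ((rho (g a) (g b))%:E <= metric_length rho a b g)%E.
Proof.
move=> ab; apply: (le_trans _ (chain_length_ub _ _ (itv_partition1 ab))).
by rewrite /= addr0.
Qed.

Lemma metric_length_ge0 (R : realType) (T : Type) (rho : T -> T -> R)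
    (g : R -> T) (a b : R) : 0 <= rho (g a) (g b) -> a <= b ->
  (0 <= metric_length rho a b g)%E.
Proof.
move=> rho0; rewrite le_eqVlt => /predU1P[->|ab]; first by rewrite metric_lengthxx.
by apply: le_trans (metric_length_ge_dist rho g ab); rewrite lee_fin.
Qed.

Lemma chain_length_le_scale (R : realType) (T U : Type) (rho : T -> T -> R)
    (sigma : U -> U -> R) (g : R -> T) (h : R -> U) (c a b : R) (s : seq R) :
  (forall x y, a <= x -> x <= y -> y <= b ->
     rho (g x) (g y) <= c * sigma (h x) (h y)) ->
  itv_partition a b s ->
  chain_length rho g a s <= c * chain_length sigma h a s.
Proof.
elim: s a => [|x s IH] a H sab /=; first by rewrite mulr0.
have xb := itv_partition_le (itv_partition_cons sab).
have ax : a < x by case: sab => /= /andP[].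
rewrite mulrDr lerD//; first by rewrite H// ltW.
apply: IH; last exact: itv_partition_cons sab.
by move=> y z xy; apply: H; rewrite (le_trans _ xy)// ltW.
Qed.

Lemma metric_length_le_scale (R : realType) (T U : Type) (rho : T -> T -> R)
    (sigma : U -> U -> R) (g : R -> T) (h : R -> U) (c a b : R) : 0 <= c ->
  (forall x y, a <= x -> x <= y -> y <= b ->
     rho (g x) (g y) <= c * sigma (h x) (h y)) ->
  (metric_length rho a b g <= c%:E * metric_length sigma a b h)%E.
Proof.
move=> c0 H; apply: metric_length_le => s sab.
apply: (@le_trans _ _ (c * chain_length sigma h a s)%:E).
  by rewrite lee_fin; apply: chain_length_le_scale sab.
by rewrite EFinM lee_wpmul2l// chain_length_ub.
Qed.

(** For [c = 0] only nonnegativity of the length remains; for [c > 0] this is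
    [metric_length_le_scale] for the factor [c^-1]. *)
Lemma metric_length_ge_scale (R : realType) (T U : Type) (rho : T -> T -> R)
    (sigma : U -> U -> R) (g : R -> T) (h : R -> U) (c a b : R) : 0 <= c ->
  0 <= rho (g a) (g b) -> a <= b ->
  (forall x y, a <= x -> x <= y -> y <= b ->
     c * sigma (h x) (h y) <= rho (g x) (g y)) ->
  (c%:E * metric_length sigma a b h <= metric_length rho a b g)%E.
Proof.
rewrite le_eqVlt => /predU1P[<- rho0 ab _|c0 rho0 ab H].
  by rewrite mul0e metric_length_ge0.
rewrite muleC -lee_pdivlMr// muleC; apply: metric_length_le_scale.
  by rewrite invr_ge0 ltW.
by move=> x y ax xy yb; rewrite ler_pdivlMl// H.
Qed.

(** Inserting [c] into a partition only increases the sum, by the triangle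
    inequality on the one subinterval that contains [c]. *)
Lemma itv_partition_split (R : realType) (T : Type) (rho : T -> T -> R)
    (g : R -> T) (a c b : R) (s : seq R) :
  (forall x y z, a <= x -> x <= y -> y <= z -> z <= b ->
     rho (g x) (g z) <= rho (g x) (g y) + rho (g y) (g z)) ->
  a <= c -> c <= b -> itv_partition a b s ->
  exists s1 s2, [/\ itv_partition a c s1, itv_partition c b s2 &
    chain_length rho g a s <= chain_length rho g a s1 + chain_length rho g c s2].
Proof.
elim: s a => [|y s IH] a tri ac cb sab.
  have ab := itv_partition_nil sab; have -> : c = a.
    by apply/eqP; rewrite eq_le ac ab cb.
  by exists [::], [::]; split => //=; rewrite ?addr0//; split.
have yb := itv_partition_le (itv_partition_cons sab).
have ay : a < y by case: sab => /= /andP[].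
move: ac; rewrite le_eqVlt => /predU1P[<-|ac].
  by exists [::], (y :: s); split => //=; rewrite ?add0r//; split.
have [yc|cy] := leP y c.
  have [|s1 [s2 [s1p s2p ?]]] := IH y _ yc cb (itv_partition_cons sab).
    by move=> p q r yp; apply: tri; rewrite (le_trans _ yp)// ltW.
  exists (y :: s1), s2; split => //=; last by rewrite -addrA lerD2l.
  by case: s1p => ? ?; split => //=; rewrite ay.
exists [:: c], (y :: s); split => /=; first exact: itv_partition1.
  case: sab => /= /andP[_ ?] ?; split => //=; exact/andP.
by rewrite addr0 addrA lerD2r tri// ltW.
Qed.

(** Concatenating partitions gives superadditivity, and [itv_partition_split]
    gives subadditivity. *)
Lemma metric_lengthD (R : realType) (T : Type) (rho : T -> T -> R)
    (g : R -> T) (a c b : R) :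
  (forall x y, a <= x -> x <= y -> y <= b -> 0 <= rho (g x) (g y)) ->
  (forall x y z, a <= x -> x <= y -> y <= z -> z <= b ->
     rho (g x) (g z) <= rho (g x) (g y) + rho (g y) (g z)) ->
  a <= c -> c <= b ->
  (metric_length rho a b g = metric_length rho a c g + metric_length rho c b g)%E.
Proof.
move=> rho0 tri ac cb; apply/eqP; rewrite eq_le; apply/andP; split.
  apply: metric_length_le => s sab.
  have [s1 [s2 [s1p s2p le12]]] := itv_partition_split tri ac cb sab.
  apply: (@le_trans _ _ (chain_length rho g a s1 + chain_length rho g c s2)%:E).
    by rewrite lee_fin.
  by rewrite EFinD leeD// chain_length_ub.
have L0 x y : a <= x -> x <= y -> y <= b -> (0 <= metric_length rho x y g)%E.
  by move=> ax xy yb; apply: metric_length_ge0 => //; exact: rho0.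
case E : (metric_length rho a b g) => [l| |]; last 2 first.
- by rewrite leey.
- by have := L0 _ _ (lexx a) (le_trans ac cb) (lexx b); rewrite E.
have H s1 s2 : itv_partition a c s1 -> itv_partition c b s2 ->
    chain_length rho g a s1 + chain_length rho g c s2 <= l.
  move=> p1 p2; have := chain_length_ub rho g (itv_partition_cat p1 p2).
  by rewrite E lee_fin chain_length_cat; case: p1 => _ /eqP ->.
have cb_le s1 : itv_partition a c s1 ->
    (metric_length rho c b g <= (l - chain_length rho g a s1)%:E)%E.
  by move=> p1; apply: metric_length_le => s2 p2; rewrite lee_fin lerBrDl H.
have : (metric_length rho a c g <= (l%:E - metric_length rho c b g))%E.
  apply: metric_length_le => s1 p1; have := cb_le s1 p1; have := L0 _ _ ac cb (lexx b).
  case: (metric_length rho c b g) => [m| |]//= _.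
  by rewrite -EFinB !lee_fin lerBrDl -lerBrDr.
have [s0 s0p] : exists s, itv_partition a c s.
  move: ac; rewrite le_eqVlt => /predU1P[->|ac]; first by exists [::]; split => /=.
  by exists [:: c]; exact: itv_partition1.
move: (cb_le _ s0p) (L0 _ _ ac cb (lexx b));
  case: (metric_length rho c b g) => [m| |]//= _ _.
by rewrite EFinN leeBrDr.
Qed.

Lemma metric_length_fin_num (R : realType) (T : Type) (rho : T -> T -> R)
    (g : R -> T) (a c d b : R) :
  (forall x y, a <= x -> x <= y -> y <= b -> 0 <= rho (g x) (g y)) ->
  (forall x y z, a <= x -> x <= y -> y <= z -> z <= b ->
     rho (g x) (g z) <= rho (g x) (g y) + rho (g y) (g z)) ->
  (metric_length rho a b g < +oo)%E ->
  a <= c -> c <= d -> d <= b -> metric_length rho c d g \is a fin_num.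
Proof.
move=> rho0 tri fin ac cd db; have cb := le_trans cd db; have ad := le_trans ac cd.
have L0 x y : a <= x -> x <= y -> y <= b -> (0 <= metric_length rho x y g)%E.
  by move=> ax xy yb; apply: metric_length_ge0 => //; exact: rho0.
rewrite ge0_fin_numE ?L0//; apply: le_lt_trans fin.
rewrite (@metric_lengthD _ _ _ _ a c b)// (@metric_lengthD _ _ _ _ c d b)//.
- apply: (@le_trans _ _ (metric_length rho c d g + metric_length rho d b g)%E).
    by rewrite leeDl// L0.
  by rewrite leeDr// L0// (le_trans ac).
- by move=> x y cx; apply: rho0; exact: le_trans cx.
- by move=> x y z cx; apply: tri; exact: le_trans cx.
Qed.

(** Cousin's lemma in the form of an induction principle: an additive property
    of intervals that holds for all short intervals around each point holds
    globally. The supremum of the endpoints [t] with [P a t] can always be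
    passed, unless it is [b]. *)
Lemma interval_additive_ind (R : realType) (P : R -> R -> Prop) (a b : R) :
  a <= b ->
  (forall x, a <= x -> x <= b -> exists2 e, 0 < e &
     forall s t, a <= s -> x - e < s -> s <= x -> x <= t -> t < x + e ->
       t <= b -> P s t) ->
  (forall x y z, a <= x -> x <= y -> y <= z -> z <= b ->
     P x y -> P y z -> P x z) ->
  P a b.
Proof.
move=> ab loc add.
pose E : set R := [set t | [/\ a <= t, t <= b & P a t]].
have Ea : E a.
  split=> //; have [e e0] := loc a (lexx a) ab; apply => //.
    by rewrite ltrBlDr ltrDl.
  by rewrite ltrDl.
have supE : has_sup E by split; [exists a | exists b => t []].
have Eub : ubound E (sup E) by exact: sup_upper_bound.
have aE : a <= sup E by exact: Eub.
have Eb : sup E <= b by apply: ge_sup; [exists a | move=> t []].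
have [e e0 Pe] := loc _ aE Eb.
have [t [at_ tb Pat] et] := sup_adherent e0 supE.
have tE : t <= sup E by apply: Eub; split.
pose u := Num.min b (sup E + e / 2).
have Eu : sup E <= u by rewrite le_min Eb lerDl divr_ge0// ltW.
have ub : u <= b by rewrite ge_min lexx.
have Ptu : P t u.
  apply: Pe => //; rewrite (@le_lt_trans _ _ (sup E + e / 2))//.
    by rewrite ge_min lexx orbT.
  by rewrite ltrD2l ltr_pdivrMr// ltr_pMr// ltr1n.
have Pau : P a u by apply: add Pat Ptu => //; exact: le_trans Eu.
have uE : u <= sup E by apply: Eub; split => //; exact: le_trans Eu.
suff <- : u = b by [].
move: uE; rewrite ge_min => /orP[bE|]; last first.
  by rewrite gerDl leNgt divr_gt0.
by apply/eqP; rewrite eq_le ub (le_trans bE Eu).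
Qed.

(** * The Euclidean distance and the boundary of a domain *)

Lemma euclid_dist_ge0 (R : realType) (n : nat) (x y : 'rV[R]_n) :
  0 <= euclid_dist x y.
Proof. exact: sqrtr_ge0. Qed.

Lemma euclid_dist_sqr (R : realType) (n : nat) (x y : 'rV[R]_n) :
  euclid_dist x y ^+ 2 = \sum_(i < n) (x 0 i - y 0 i) ^+ 2.
Proof. by rewrite sqr_sqrtr// sumr_ge0// => i _; exact: sqr_ge0. Qed.

Lemma euclid_distxx (R : realType) (n : nat) (x : 'rV[R]_n) :
  euclid_dist x x = 0.
Proof.
by rewrite /euclid_dist big1 ?sqrtr0// => i _; rewrite subrr expr0n.
Qed.

Lemma euclid_distC (R : realType) (n : nat) (x y : 'rV[R]_n) :
  euclid_dist x y = euclid_dist y x.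
Proof.
by congr Num.sqrt; apply: eq_bigr => i _; rewrite -sqrrN opprB.
Qed.

(** Summing (B a_i - A b_i)^2 >= 0, with A and B the two norms. *)
Lemma cauchy_schwarz_sum (R : realType) (n : nat) (a b : 'I_n -> R) :
  \sum_(i < n) a i * b i <=
  Num.sqrt (\sum_(i < n) a i ^+ 2) * Num.sqrt (\sum_(i < n) b i ^+ 2).
Proof.
have sq0 (c : 'I_n -> R) : 0 <= \sum_(i < n) c i ^+ 2.
  by rewrite sumr_ge0// => i _; exact: sqr_ge0.
set A := Num.sqrt _; set B := Num.sqrt _.
have A0 : 0 <= A by exact: sqrtr_ge0.
have B0 : 0 <= B by exact: sqrtr_ge0.
have AE : A ^+ 2 = \sum_(i < n) a i ^+ 2 by rewrite sqr_sqrtr.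
have BE : B ^+ 2 = \sum_(i < n) b i ^+ 2 by rewrite sqr_sqrtr.
have vanish (c : 'I_n -> R) : \sum_(i < n) c i ^+ 2 = 0 -> forall i, c i = 0.
  move=> /eqP; rewrite psumr_eq0; last by move=> i _; exact: sqr_ge0.
  by move=> /allP c0 i; have := c0 i (mem_index_enum i); rewrite /= sqrf_eq0 => /eqP.
have [A00|An0] := eqVneq A 0.
  rewrite A00 mul0r big1// => i _; rewrite vanish ?mul0r//.
  by rewrite -AE A00 expr0n.
have [B00|Bn0] := eqVneq B 0.
  rewrite B00 mulr0 big1// => i _; rewrite (vanish b) ?mulr0//.
  by rewrite -BE B00 expr0n.
have Ap : 0 < A by rewrite lt0r An0.
have Bp : 0 < B by rewrite lt0r Bn0.
rewrite -(@ler_pM2l _ (2 * (A * B))) ?mulr_gt0// mulr_sumr.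
apply: (@le_trans _ _ (\sum_(i < n) (B ^+ 2 * a i ^+ 2 + A ^+ 2 * b i ^+ 2))).
  apply: ler_sum => i _; rewrite -subr_ge0.
  rewrite (_ : _ - _ = (B * a i - A * b i) ^+ 2) ?sqr_ge0//; ring.
rewrite big_split/= -!mulr_sumr -AE -BE le_eqVlt; apply/orP; left.
apply/eqP; ring.
Qed.

Lemma euclid_dist_triangle (R : realType) (n : nat) (x y z : 'rV[R]_n) :
  euclid_dist x z <= euclid_dist x y + euclid_dist y z.
Proof.
rewrite -(@ler_pXn2r _ 2)// ?nnegrE ?addr_ge0 ?euclid_dist_ge0//.
rewrite sqrrD !euclid_dist_sqr.
have := cauchy_schwarz_sum (fun i => x 0 i - y 0 i) (fun i => y 0 i - z 0 i).
rewrite -/(euclid_dist x y) -/(euclid_dist y z) => CS.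
apply: (@le_trans _ _ (\sum_(i < n) (x 0 i - y 0 i) ^+ 2 +
   (\sum_(i < n) (x 0 i - y 0 i) * (y 0 i - z 0 i)) *+ 2 +
   \sum_(i < n) (y 0 i - z 0 i) ^+ 2)).
  rewrite mulr2n -!big_split/=; apply: ler_sum => i _.
  by rewrite le_eqVlt; apply/orP; left; apply/eqP; ring.
by rewrite lerD2r lerD2l lerMn2r CS.
Qed.

Lemma coord_le_euclid_dist (R : realType) (n : nat) (x y : 'rV[R]_n) (i : 'I_n) :
  `|x 0 i - y 0 i| <= euclid_dist x y.
Proof.
rewrite -sqrtr_sqr ler_wsqrtr// (bigD1 i)//= lerDl sumr_ge0// => j _.
exact: sqr_ge0.
Qed.

Lemma euclid_dist_le_sum (R : realType) (n : nat) (x y : 'rV[R]_n) :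
  euclid_dist x y <= \sum_(i < n) `|x 0 i - y 0 i|.
Proof.
have s0 : 0 <= \sum_(i < n) `|x 0 i - y 0 i| by rewrite sumr_ge0.
rewrite -(ger0_norm s0) -sqrtr_sqr ler_wsqrtr// expr2 mulr_suml.
apply: ler_sum => i _; rewrite -real_normK ?num_real// expr2 ler_wpM2l//.
by rewrite (bigD1 i)//= lerDl sumr_ge0.
Qed.

Lemma euclid_dist_eq0 (R : realType) (n : nat) (x y : 'rV[R]_n) :
  euclid_dist x y = 0 -> x = y.
Proof.
move=> xy0; apply/rowP => i; apply/eqP; rewrite -subr_eq0 -normr_le0 -xy0.
exact: coord_le_euclid_dist.
Qed.

Lemma euclid_dist_line (R : realType) (n : nat) (x v : 'rV[R]_n) (s t : R) :
  euclid_dist (x + s *: v) (x + t *: v) = `|s - t| * euclid_dist v 0.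
Proof.
rewrite -sqrtr_sqr -sqrtrM ?sqr_ge0//; congr Num.sqrt.
by rewrite mulr_sumr; apply: eq_bigr => i _; rewrite !mxE; ring.
Qed.

Lemma nbhs_euclid_ball (R : realType) (n : nat) (x : 'rV[R]_n) (r : R) :
  0 < r -> \forall y \near x, euclid_dist x y < r.
Proof.
move=> r0; apply/nbhs_ballP; exists (r / n.+1%:R) => /=; first by rewrite divr_gt0.
move=> y xy; apply: le_lt_trans (euclid_dist_le_sum x y) _.
apply: (@le_lt_trans _ _ (\sum_(i < n) r / n.+1%:R)).
  by apply: ler_sum => i _; exact/ltW/(xy.2 0 i).
by rewrite sumr_const card_ord -[X in X < _]mulr_natr mulrAC ltr_pdivrMr// ltr_pM2l// ltr_nat.
Qed.

Lemma nbhs_euclidP (R : realType) (n : nat) (x : 'rV[R]_n) (U : set 'rV[R]_n) :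
  nbhs x U -> exists2 r, 0 < r & forall y, euclid_dist x y < r -> U y.
Proof.
move=> /nbhs_ballP[r r0 rU]; exists r => // y xy; apply: rU; split=> // i j.
by rewrite (ord1 i); apply: le_lt_trans xy; exact: coord_le_euclid_dist.
Qed.

(** Follow the segment from [x] to [y] as long as it stays in [D]: the last
    parameter gives a boundary point, no farther from [x] than [y] is. This
    shows both that the boundary is nonempty and that [delta_dom D x] is the
    radius of a ball contained in [D]. *)
Lemma segment_meets_boundary (R : realType) (n : nat) (D : set 'rV[R]_n)
    (x y : 'rV[R]_n) : open D -> D x -> ~ D y ->
  exists2 xi, top_boundary D xi & euclid_dist x xi <= euclid_dist x y.
Proof.
move=> oD Dx Dy.
pose f (t : R) := x + t *: (y - x).
have f1 : f 1 = y by rewrite /f scale1r addrC subrK.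
have f0 : f 0 = x by rewrite /f scale0r addr0.
have distf s t : euclid_dist (f s) (f t) = `|s - t| * euclid_dist x y.
  rewrite /f euclid_dist_line; congr (_ * _); rewrite euclid_distC.
  rewrite -[in LHS](addrK x 0) add0r.
  rewrite /euclid_dist; congr Num.sqrt; apply: eq_bigr => i _.
  by rewrite !mxE; ring.
pose E : set R := [set t | [/\ 0 <= t, t <= 1 & forall s, 0 <= s -> s <= t -> D (f s)]].
have E0 : E 0.
  by split=> // s s0 s0'; rewrite (_ : s = 0) ?f0//; apply/eqP; rewrite eq_le s0'.
have supE : has_sup E by split; [exists 0 | exists 1 => t []].
pose c := sup E.
have c0 : 0 <= c by exact: (sup_upper_bound supE).
have c1 : c <= 1 by apply: ge_sup; [exists 0 | move=> t []].
(* The segment stays in [D] strictly before the parameter [c]. *)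
have below s : 0 <= s -> s < c -> D (f s).
  move=> s0 sc; have cs : 0 < c - s by rewrite subr_gt0.
  have [t [_ _ tD] st] := sup_adherent cs supE.
  by apply: tD => //; apply: ltW; move: st; rewrite subKr.
exists (f c); last first.
  rewrite -[X in euclid_dist X _]f0 distf sub0r normrN ger0_norm//.
  by rewrite ler_piMl// euclid_dist_ge0.
have xy0 : 0 < euclid_dist x y.
  rewrite lt0r euclid_dist_ge0 andbT; apply/eqP => /euclid_dist_eq0 xy.
  by apply: Dy; rewrite -xy.
split.
  move=> U /nbhs_euclidP[r r0 rU].
  have [c00|cn0] := eqVneq c 0.
    by exists x; split => //; apply: rU; rewrite c00 f0 euclid_distxx.
  pose s := Num.max 0 (c - r / (2 * euclid_dist x y)).
  have s0 : 0 <= s by rewrite le_max lexx.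
  have q0 : 0 < r / (2 * euclid_dist x y) by rewrite divr_gt0// mulr_gt0.
  have sc : s < c by rewrite gt_max lt0r cn0 c0/= gtrDl oppr_lt0.
  exists (f s); split; first exact: below.
  apply: rU; rewrite distf ger0_norm ?subr_ge0 1?ltW//.
  apply: (@le_lt_trans _ _ (r / (2 * euclid_dist x y) * euclid_dist x y)).
    by rewrite ler_pM2r// lerBlDr addrC -lerBlDr le_max lexx orbT.
  rewrite (_ : _ * _ = r / 2); last by field; rewrite gt_eqF.
  by rewrite ltr_pdivrMr// ltr_pMr// ltr1n.
rewrite (iffLR (interior_id _))// => Dfc.
have [r r0 rD] : exists2 r, 0 < r & forall z, euclid_dist (f c) z < r -> D z.
  by apply: nbhs_euclidP; exact: open_nbhs_nbhs.
pose q := r / (2 * euclid_dist x y).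
have q0 : 0 < q by rewrite divr_gt0// mulr_gt0.
(* If [f c] were in [D], the segment would stay in [D] up to the parameter
   [t], which exceeds [c] unless [c = 1]; but [f 1] is [y]. *)
pose t := Num.min 1 (c + q).
have ct : c <= t by rewrite le_min c1 lerDl ltW.
have Et : E t.
  split; [exact: le_trans ct| by rewrite ge_min lexx|] => s s0 st.
  have [sc|cs] := ltP s c; first exact: below.
  apply: rD; rewrite distf distrC ger0_norm ?subr_ge0//.
  apply: (@le_lt_trans _ _ (q * euclid_dist x y)).
    rewrite ler_pM2r// lerBlDl (le_trans st)//.
    by rewrite ge_min lexx orbT.
  rewrite (_ : _ * _ = r / 2); last by rewrite /q; field; rewrite gt_eqF.
  by rewrite ltr_pdivrMr// ltr_pMr// ltr1n.
have tc : t <= c by exact: (sup_upper_bound supE).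
move: tc; rewrite ge_min => /orP[c1'|]; last by rewrite gerDl leNgt q0.
apply: Dy; rewrite -f1; suff <- : c = 1 by [].
by apply/eqP; rewrite eq_le c1.
Qed.

Lemma dist_boundary_has_lbound (R : realType) (n : nat) (D : set 'rV[R]_n)
    (z : 'rV[R]_n) : has_lbound [set euclid_dist z xi | xi in top_boundary D].
Proof. by exists 0 => _ [xi _ <-]; exact: euclid_dist_ge0. Qed.

Lemma delta_dom_le (R : realType) (n : nat) (D : set 'rV[R]_n)
    (z xi : 'rV[R]_n) : top_boundary D xi -> delta_dom D z <= euclid_dist z xi.
Proof.
by move=> Dxi; apply: ge_inf; [exact: dist_boundary_has_lbound | exists xi].
Qed.

Lemma le_delta_dom (R : realType) (n : nat) (D : set 'rV[R]_n)
    (z : 'rV[R]_n) (r : R) : top_boundary D !=set0 ->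
  (forall xi, top_boundary D xi -> r <= euclid_dist z xi) -> r <= delta_dom D z.
Proof.
by move=> [xi0 Dxi0] H; apply: lb_le_inf; [exists (euclid_dist z xi0), xi0 |
  move=> _ [xi Dxi <-]; exact: H].
Qed.

Lemma boundary_nonempty (R : realType) (n : nat) (D : set 'rV[R]_n) :
  D !=set0 -> open D -> D <> setT -> top_boundary D !=set0.
Proof.
move=> [x Dx] oD DT; suff [y Dy] : exists y, ~ D y.
  by have [xi Dxi _] := segment_meets_boundary oD Dx Dy; exists xi.
apply: contrapT => /forallNP H; apply: DT; apply/seteqP; split => // y _.
by apply: contrapT; exact: H.
Qed.

Lemma delta_dom_lipschitz (R : realType) (n : nat) (D : set 'rV[R]_n)
    (x y : 'rV[R]_n) : top_boundary D !=set0 ->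
  `|delta_dom D x - delta_dom D y| <= euclid_dist x y.
Proof.
move=> bD0.
have one u v : delta_dom D u <= delta_dom D v + euclid_dist u v.
  rewrite -lerBlDr; apply: le_delta_dom => // xi Dxi.
  rewrite lerBlDr addrC; apply: le_trans (euclid_dist_triangle u v xi).
  exact: delta_dom_le.
rewrite ler_norml lerNl opprB !lerBlDl one andbT.
by rewrite euclid_distC; exact: one.
Qed.

Lemma delta_dom_gt0 (R : realType) (n : nat) (D : set 'rV[R]_n)
    (x : 'rV[R]_n) : top_boundary D !=set0 -> open D -> D x ->
  0 < delta_dom D x.
Proof.
move=> bD0 oD Dx; have [r r0 rD] : exists2 r, 0 < r &
    forall z, euclid_dist x z < r -> D z.
  by apply: nbhs_euclidP; exact: open_nbhs_nbhs.
apply: (lt_le_trans r0); apply: le_delta_dom => // xi [_].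
rewrite (iffLR (interior_id _))// => Dxi.
by rewrite leNgt; apply/negP => /rD.
Qed.

Lemma delta_dom_ball (R : realType) (n : nat) (D : set 'rV[R]_n)
    (x y : 'rV[R]_n) : open D -> D x -> euclid_dist x y < delta_dom D x -> D y.
Proof.
move=> oD Dx; rewrite ltNge => /negP xy; apply: contrapT => Dy; apply: xy.
have [xi Dxi xxi] := segment_meets_boundary oD Dx Dy.
by apply: le_trans xxi; exact: delta_dom_le.
Qed.

(** The Euclidean ball around [x] of radius [delta_dom D x] lies in [D], and it
    contains pairs of points [x + r v], [x - r v] with [r] arbitrarily close to
    the radius. *)
Lemma delta_dom_diam (R : realType) (n : nat) (D : set 'rV[R]_n)
    (x : 'rV[R]_n) (d : R) : (0 < n)%N -> open D -> D x ->
  euclid_diam D = d%:E -> 2 * delta_dom D x <= d.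
Proof.
case: n D x => // n D x _ oD Dx dD.
pose v : 'rV[R]_n.+1 := delta_mx 0 ord0.
have v1 : euclid_dist v 0 = 1.
  rewrite /euclid_dist (bigD1 ord0)//= big1 ?addr0.
    by rewrite !mxE/= subr0 expr1n sqrtr1.
  by move=> i i0; rewrite !mxE/= (negbTE i0) subr0 expr0n.
have distv s : euclid_dist x (x + s *: v) = `|s|.
  by rewrite -[X in euclid_dist X _](addr0 x) -(scale0r v) euclid_dist_line v1
     sub0r normrN mulr1.
rewrite leNgt; apply/negP => dlt.
have d0 : 0 <= d.
  rewrite -lee_fin -dD; apply: ereal_sup_ubound; exists x, x.
  by split=> //; rewrite euclid_distxx.
have /midf_lt[] : d / 2 < delta_dom D x by rewrite ltr_pdivrMr// mulrC.
set r := (d / 2 + _) / 2 => dr rdelta.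
have r0 : 0 <= r by rewrite (le_trans _ (ltW dr))// divr_ge0.
have Dp : D (x + r *: v) by apply: delta_dom_ball Dx _ => //; rewrite distv ger0_norm.
have Dm : D (x + (- r) *: v).
  by apply: delta_dom_ball Dx _ => //; rewrite distv normrN ger0_norm.
have : ((euclid_dist (x + r *: v) (x + (- r) *: v))%:E <= d%:E)%E.
  by rewrite -dD; apply: ereal_sup_ubound; exists (x + r *: v), (x + (- r) *: v).
rewrite lee_fin euclid_dist_line v1 mulr1 opprK ger0_norm ?addr_ge0// leNgt.
by move/negP; apply; rewrite -mulr2n -mulr_natr -ltr_pdivrMr.
Qed.

(** All that the metric needs to know about [D]. In the bounded case
    eta = delta (d - delta) and
    eta x - eta y = (d - delta x - delta y) (delta x - delta y), where
    2 delta <= d makes the first factor at most d in absolute value and makes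
    eta positive. *)
Lemma diam_factor_eta_dom (R : realType) (n : nat) (D : set 'rV[R]_n) :
  (2 <= n)%N -> domain D -> D <> setT ->
  [/\ 0 < diam_factor D, forall x, D x -> 0 < eta_dom D x &
   forall x y, D x -> D y ->
     `|eta_dom D x - eta_dom D y| <= diam_factor D * euclid_dist x y].
Proof.
move=> n2 [D0 oD _] DT; have bD := boundary_nonempty D0 oD DT.
have n0 : (0 < n)%N by apply: leq_trans n2.
rewrite /diam_factor /eta_dom.
case dD : (euclid_diam D) => [d| |]; last 2 first.
1,2: split=> // [x Dx|x y _ _]; first exact: delta_dom_gt0;
  by rewrite mul1r; exact: delta_dom_lipschitz.
have dpos x : D x -> 0 < delta_dom D x by move=> Dx; exact: delta_dom_gt0.
have dle x : D x -> 2 * delta_dom D x <= d by move=> Dx; exact: delta_dom_diam dD.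
split.
- by case: D0 => x Dx; have := dpos x Dx; have := dle x Dx; lra.
- move=> x Dx; have := dpos x Dx; have := dle x Dx => ? ?.
  by rewrite mulr_gt0//; lra.
- move=> x y Dx Dy; rewrite (_ : _ - _ =
    (d - delta_dom D x - delta_dom D y) * (delta_dom D x - delta_dom D y)); last by ring.
  rewrite normrM ler_pM//; last exact: delta_dom_lipschitz.
  have := dpos x Dx; have := dle x Dx; have := dpos y Dy; have := dle y Dy.
  by move=> ? ? ? ?; rewrite ger0_norm; lra.
Qed.

(** * Arc length of a rectifiable path *)

Lemma within_continuousP (R : realType) (A : set R) (f : R -> R) :
  {within A, continuous f} <->
  forall x, A x -> forall e : R, 0 < e -> exists2 d : R, 0 < d &
    forall y, A y -> `|x - y| < d -> `|f x - f y| < e.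
Proof.
split=> [/subspace_continuousP cf x Ax e e0|H].
  have /cvgrPdist_lt/(_ e e0) := cf x Ax.
  rewrite near_withinE => /nbhs_ballP[d d0 dA]; exists d => // y Ay xy.
  exact: (dA y xy Ay).
apply/subspace_continuousP => x Ax; apply/cvgrPdist_lt => e e0.
have [d d0 Hd] := H x Ax e e0; rewrite near_withinE.
by apply/nbhs_ballP; exists d => // y xy Ay; exact: Hd.
Qed.

(** The total variation is the length for the distance of R, so additivity and
    the comparison lemmas apply to it; conversely, its continuity passes to the
    arc length. *)
Lemma total_variationE (R : realType) (a b : R) (f : R -> R) :
  total_variation a b f = metric_length (fun x y : R => `|y - x|) a b f.
Proof.
rewrite /total_variation /metric_length; congr ereal_sup.
apply/seteqP; split => x /=.
  by move=> [_ [s sab <-] <-]; exists s.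
by move=> [s sab <-]; exists (variation a b f s) => //; exists s.
Qed.

Lemma coord_variation_le_length (R : realType) (n : nat) (g : R -> 'rV[R]_n)
    (a b : R) (i : 'I_n) :
  (total_variation a b (fun t => g t 0%R i) <=
   metric_length (@euclid_dist R n) a b g)%E.
Proof.
rewrite total_variationE -[leRHS]mul1e.
apply: metric_length_le_scale => // x y _ _ _.
by rewrite mul1r euclid_distC coord_le_euclid_dist.
Qed.

Lemma length_le_sum_coord_variation (R : realType) (n : nat)
    (g : R -> 'rV[R]_n) (a b : R) :
  (metric_length (@euclid_dist R n) a b g <=
   \sum_(i < n) total_variation a b (fun t => g t 0%R i))%E.
Proof.
apply: metric_length_le => s sab.
apply: (@le_trans _ _ (\sum_(i < n)
    (chain_length (fun x y : R => `|y - x|) (fun t => g t 0%R i) a s)%:E)%E).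
  rewrite sumEFin lee_fin; elim: s a {sab} => [|x s IH] a /=.
    by rewrite sumr_ge0.
  rewrite big_split/= lerD//.
  by rewrite euclid_distC; exact: euclid_dist_le_sum.
by apply: lee_sum => i _; rewrite total_variationE; exact: chain_length_ub.
Qed.

Definition arclength (R : realType) (n : nat) (g : R -> 'rV[R]_n) (a t : R) : R :=
  fine (metric_length (@euclid_dist R n) a t g).

Lemma arclengthB (R : realType) (n : nat) (a b : R) (g : R -> 'rV[R]_n)
    (s t : R) : rectifiable_path a b g -> a <= s -> s <= t -> t <= b ->
  metric_length (@euclid_dist R n) s t g
  = (arclength g a t - arclength g a s)%:E.
Proof.
move=> [ab _ fin] as_ st tb.
have F c d : a <= c -> c <= d -> d <= b ->
    metric_length (@euclid_dist R n) c d g \is a fin_num.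
  move=> ac cd db; apply: (@metric_length_fin_num _ _ _ _ a c d b) => //.
    by move=> *; exact: euclid_dist_ge0.
  by move=> *; exact: euclid_dist_triangle.
have sb := le_trans st tb.
rewrite /arclength (@metric_lengthD _ _ _ _ a s t)//; last 2 first.
- by move=> *; exact: euclid_dist_ge0.
- by move=> *; exact: euclid_dist_triangle.
by rewrite fineD ?F// addrAC subrr add0r fineK// F.
Qed.

Lemma arclength_dist (R : realType) (n : nat) (a b : R) (g : R -> 'rV[R]_n)
    (s t : R) : rectifiable_path a b g -> a <= s -> s <= t -> t <= b ->
  euclid_dist (g s) (g t) <= arclength g a t - arclength g a s.
Proof.
move=> rg as_; rewrite le_eqVlt => /predU1P[<-|st] tb.
  by rewrite euclid_distxx subrr.
rewrite -lee_fin -(arclengthB rg as_ (ltW st) tb).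
exact: metric_length_ge_dist.
Qed.

Lemma arclength_le (R : realType) (n : nat) (a b : R) (g : R -> 'rV[R]_n)
    (s t : R) : rectifiable_path a b g -> a <= s -> s <= t -> t <= b ->
  arclength g a s <= arclength g a t.
Proof.
move=> rg as_ st tb; rewrite -subr_ge0.
by apply: le_trans (arclength_dist rg as_ st tb); exact: euclid_dist_ge0.
Qed.

Lemma arclength_dist_norm (R : realType) (n : nat) (a b : R)
    (g : R -> 'rV[R]_n) (s t : R) : rectifiable_path a b g ->
  s \in `[a, b] -> t \in `[a, b] ->
  euclid_dist (g s) (g t) <= `|arclength g a s - arclength g a t|.
Proof.
move=> rg; rewrite !in_itv/= => /andP[as_ sb] /andP[at_ tb].
have [st|/ltW ts] := leP s t.
  by rewrite distrC ger0_norm ?subr_ge0 ?(arclength_le rg)// (arclength_dist rg).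
rewrite ger0_norm ?subr_ge0 ?(arclength_le rg)// euclid_distC.
exact: (arclength_dist rg).
Qed.

(** The increments of the arc length are at most the sums of the increments of
    the total variations of the coordinates, and these are continuous. *)
Lemma arclength_continuous (R : realType) (n : nat) (a b : R)
    (g : R -> 'rV[R]_n) : rectifiable_path a b g ->
  {within `[a, b], continuous (arclength g a)}.
Proof.
move=> rg; have [ab cg fin] := rg.
pose f (i : 'I_n) t := g t 0 i.
pose V (i : 'I_n) t := fine (total_variation a t (f i)).
have TVfin i s t : a <= s -> s <= t -> t <= b ->
    total_variation s t (f i) \is a fin_num.
  move=> as_ st tb; rewrite ge0_fin_numE ?total_variation_ge0//.
  apply: le_lt_trans (coord_variation_le_length g s t i) _.
  by rewrite (arclengthB rg)// ltry.
have cV i : {within `[a, b], continuous (V i)}.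
  apply: total_variation_continuous => //.
    apply/subspace_continuousP => x xab; move/subspace_continuousP in cg.
    exact: (cvg_comp _ _ (cg x xab) (@coord_continuous R 1 n 0 i (g x))).
  by apply/(bounded_variationP _ (ltW ab)); apply: TVfin => //; exact: ltW.
have VB i s t : a <= s -> s <= t -> t <= b ->
    total_variation s t (f i) = (V i t - V i s)%:E.
  move=> as_ st tb; have sb := le_trans st tb.
  rewrite /V (total_variationD (f i) as_ st) fineD ?TVfin//.
  by rewrite addrAC subrr add0r fineK// TVfin.
have incr s t : a <= s -> s <= t -> t <= b ->
    arclength g a t - arclength g a s <= \sum_(i < n) `|V i t - V i s|.
  move=> as_ st tb; rewrite -lee_fin -(arclengthB rg as_ st tb).
  apply: le_trans (length_le_sum_coord_variation g s t) _.
  rewrite -sumEFin; apply: lee_sum => i _.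
  by rewrite (VB i s t)// lee_fin ler_norm.
apply/within_continuousP => x; rewrite /= in_itv/= => /andP[ax xb] e e0.
have /fin_all_exists2[d d0 Hd] (i : 'I_n) : exists2 d, 0 < d &
    forall y, y \in `[a, b] -> `|x - y| < d -> `|V i x - V i y| < e / n.+1%:R.
  have /within_continuousP/(_ x) := cV i; rewrite /= in_itv/= ax xb.
  by apply => //; rewrite divr_gt0.
exists (\big[Num.min/1]_(i < n) d i); first by rewrite lt_bigmin.
move=> y; rewrite /= in_itv/= => /andP[ay yb] xy.
have Hi i : `|V i x - V i y| < e / n.+1%:R.
  apply: Hd; first by rewrite in_itv/= ay.
  by apply: lt_le_trans xy _; rewrite bigmin_le_cond.
apply: (@le_lt_trans _ _ (\sum_(i < n) `|V i x - V i y|)).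
  have [xy'|/ltW yx] := leP x y.
    rewrite distrC ger0_norm ?subr_ge0 ?(arclength_le rg)//.
    by under eq_bigr do rewrite distrC; exact: incr.
  by rewrite ger0_norm ?subr_ge0 ?(arclength_le rg)//; exact: incr.
apply: (@le_lt_trans _ _ (\sum_(i < n) e / n.+1%:R)).
  by apply: ler_sum => i _; exact/ltW/Hi.
by rewrite sumr_const card_ord -[X in X < _]mulr_natr mulrAC ltr_pdivrMr//
   ltr_pM2l// ltr_nat.
Qed.

(** Intermediate value theorem for [arclength]; the preimage is found inside
    any prescribed parameter interval. *)
Lemma arclength_onto (R : realType) (n : nat) (a b : R) (g : R -> 'rV[R]_n)
    (s t u : R) : rectifiable_path a b g -> a <= s -> s <= t -> t <= b ->
  arclength g a s <= u -> u <= arclength g a t ->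
  exists2 p, s <= p <= t & arclength g a p = u.
Proof.
move=> rg as_ st tb su ut.
have cS : {within `[s, t], continuous (arclength g a)}.
  apply: continuous_subspaceW (arclength_continuous rg).
  by apply: subset_itv; rewrite bnd_simp.
have [|p] := IVT st cS (v := u).
  by rewrite ge_min su le_max ut orbT.
by rewrite in_itv/= => spt pu; exists p.
Qed.

(** Two parameters with the same arc length are at distance 0, so the choice
    made in [arclength_param] is immaterial. *)
Lemma arclength_paramE (R : realType) (n : nat) (a b : R) (g : R -> 'rV[R]_n)
    (t : R) : rectifiable_path a b g -> t \in `[a, b] ->
  arclength_param a b g (arclength g a t) = g t.
Proof.
move=> rg tab; rewrite /arclength_param.
have lenE s : s \in `[a, b] ->
    metric_length (@euclid_dist R n) a s g = (arclength g a s)%:E.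
  rewrite in_itv/= => /andP[as_ sb]; rewrite (arclengthB rg)//.
  by rewrite {2}/arclength metric_lengthxx subr0.
case: xgetP => [s _ [sab sE]|/(_ t)]; last by case; split => //; exact: lenE.
apply: euclid_dist_eq0; apply/eqP; rewrite eq_le euclid_dist_ge0 andbT.
apply: le_trans (arclength_dist_norm rg sab tab) _.
by move: sE; rewrite lenE// => -[->]; rewrite subrr normr0.
Qed.

(** * The length of a path as a line integral of a density *)

(** To first order, [rho] is [w] times the Euclidean distance: near each point
    [x] of [D], both the quotient of [rho] by the Euclidean distance and the
    weight [w] lie in one interval [c1, c2] of length at most [e]. The constant
    [c1] is required to be nonnegative so that it can be compared with lengths
    and integrals in the extended reals. *)
Definition length_density (R : realType) (n : nat) (D : set 'rV[R]_n)
    (rho : 'rV[R]_n -> 'rV[R]_n -> R) (w : 'rV[R]_n -> R) : Prop :=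
  forall x, D x -> forall e : R, 0 < e -> exists r c1 c2 : R,
    [/\ 0 < r, 0 <= c1, c2 <= c1 + e &
      forall y z, D y -> D z -> euclid_dist x y < r -> euclid_dist x z < r ->
        [/\ c1 * euclid_dist y z <= rho y z, rho y z <= c2 * euclid_dist y z,
            c1 <= w y & w y <= c2]].

(** The arc-length parametrization is 1-Lipschitz, and [length_density] contains
    the continuity of the weight; so the integrand of [line_integral] is
    continuous, hence measurable. *)
Lemma density_along_arclength (R : realType) (n : nat) (D : set 'rV[R]_n)
    (rho : 'rV[R]_n -> 'rV[R]_n -> R) (w : 'rV[R]_n -> R) (a b : R)
    (g : R -> 'rV[R]_n) :
  rectifiable_path a b g -> g @` `[a, b] `<=` D -> length_density D rho w ->
  {within `[0, arclength g a b],
     continuous (fun u => w (arclength_param a b g u))} /\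
  forall u : R, u \in `[0, arclength g a b] -> 0 <= w (arclength_param a b g u).
Proof.
move=> rg gD dens.
have ab : a <= b by case: rg => /ltW.
have S0 : arclength g a a = 0 by rewrite /arclength metric_lengthxx.
have param (u : R) : u \in `[0, arclength g a b] ->
    exists t, [/\ t \in `[a, b], arclength g a t = u &
      arclength_param a b g u = g t].
  rewrite in_itv/= => /andP[u0 uL].
  have [||t tab tu] := arclength_onto (u := u) rg (lexx a) ab (lexx b) => //.
    by rewrite S0.
  by exists t; split => //; rewrite -tu arclength_paramE.
split; last first.
  move=> u /param[t [tab _ ->]]; have Dt : D (g t) by apply: gD; exists t.
  have [r [c1 [c2 [r0 c10 _ H]]]] := dens _ Dt 1 ltr01.
  have tt : euclid_dist (g t) (g t) < r by rewrite euclid_distxx.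
  by have [_ _ + _] := H _ _ Dt Dt tt tt; exact: le_trans.
apply/within_continuousP => u uL e e0.
have [t [tab tu ->]] := param _ uL; have Dt : D (g t) by apply: gD; exists t.
have e2 : 0 < e / 2 by rewrite divr_gt0.
have [r [c1 [c2 [r0 c10 c12 H]]]] := dens _ Dt (e / 2) e2.
exists r => // v vL uv; have [s [sab sv ->]] := param _ vL.
have Ds : D (g s) by apply: gD; exists s.
have ts : euclid_dist (g t) (g s) < r.
  by apply: le_lt_trans uv; rewrite -tu -sv; exact: arclength_dist_norm rg tab sab.
have tt : euclid_dist (g t) (g t) < r by rewrite euclid_distxx.
have [_ _ ? ?] := H _ _ Dt Ds tt ts.
have [_ _ ? ?] := H _ _ Ds Dt ts tt.
by rewrite ltr_norml; apply/andP; split; lra.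
Qed.

(** Both the length for [rho] and the integral of the weight over the
    corresponding arc-length interval are additive in the parameter interval.
    On a short interval both lie between [c1] and [c2] times the Euclidean
    length, so they differ by at most [e] times the Euclidean length. This
    estimate is additive, hence global by [interval_additive_ind]; then [e]
    tends to 0. *)
Lemma line_integral_metric_length (R : realType) (n : nat) (D : set 'rV[R]_n)
    (rho : 'rV[R]_n -> 'rV[R]_n -> R) (w : 'rV[R]_n -> R) (a b : R)
    (g : R -> 'rV[R]_n) :
  (forall x y, D x -> D y -> 0 <= rho x y) ->
  (forall x y z, D x -> D y -> D z -> rho x z <= rho x y + rho y z) ->
  length_density D rho w ->
  rectifiable_path a b g -> g @` `[a, b] `<=` D ->
  line_integral w a b g = metric_length rho a b g.
Proof.
move=> rho0 tri dens rg gD.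
have ab : a <= b by case: rg => /ltW.
have Dg t : a <= t -> t <= b -> D (g t).
  by move=> at_ tb; apply: gD; exists t => //=; rewrite in_itv/= at_.
have rho0g x y : a <= x -> x <= y -> y <= b -> 0 <= rho (g x) (g y).
  move=> ax xy yb; apply: rho0; apply: Dg => //; first exact: le_trans yb.
  exact: le_trans xy.
have trig x y z : a <= x -> x <= y -> y <= z -> z <= b ->
    rho (g x) (g z) <= rho (g x) (g y) + rho (g y) (g z).
  move=> ax xy yz zb; have ay := le_trans ax xy; have yb := le_trans yz zb.
  have az := le_trans ay yz; have xb := le_trans xy yb.
  by apply: tri; exact: Dg.
have [Wc W0] := density_along_arclength rg gD dens.
set W := fun u => w (arclength_param a b g u) in Wc W0.
pose S := arclength g a; pose L := S b.
have S0 : S a = 0 by rewrite /S /arclength metric_lengthxx.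
have Smono s t : a <= s -> s <= t -> t <= b -> S s <= S t by exact: arclength_le rg.
have mW s t : a <= s -> s <= t -> t <= b ->
    measurable_fun `]S s, S t] (EFin \o W).
  move=> as_ st tb; apply/measurable_EFinP.
  apply: (@measurable_funS _ _ _ _ `[0, L]%classic) => //.
    apply: subset_itv; rewrite bnd_simp; last exact: Smono (le_trans as_ st) _ _.
    by rewrite -S0 Smono// (le_trans st).
  exact: subspace_continuous_measurable_fun.
have W0' s t u : a <= s -> s <= t -> t <= b -> `]S s, S t]%classic u ->
    (0 <= (W u)%:E)%E.
  move=> as_ st tb; rewrite /= in_itv/= lee_fin => /andP[su ut].
  apply: W0; rewrite in_itv/= (le_trans ut) ?Smono ?(le_trans as_)// andbT.
  by rewrite -S0 (le_trans _ (ltW su))// Smono// (le_trans st).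
(* Half-open intervals, so that consecutive pieces are disjoint even when the
   path is constant on one of them. *)
pose I s t := (\int[@lebesgue_measure R]_(u in `]S s, S t]) (W u)%:E)%E.
have I0 s t : a <= s -> s <= t -> t <= b -> (0 <= I s t)%E.
  by move=> as_ st tb; apply: integral_ge0 => u; exact: W0'.
have -> : line_integral w a b g = I a b.
  rewrite /line_integral /I S0 integral_itv_obnd_cbnd//.
  by rewrite -[X in `]X, _]]S0; exact: mW.
have main e : 0 < e ->
    (metric_length rho a b g <= I a b + (e * (S b - S a))%:E)%E /\
    (I a b <= metric_length rho a b g + (e * (S b - S a))%:E)%E.
  move=> e0; pose P s t := [/\ a <= s, s <= t & t <= b] ->
    (metric_length rho s t g <= I s t + (e * (S t - S s))%:E)%E /\
    (I s t <= metric_length rho s t g + (e * (S t - S s))%:E)%E.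
  suff /(_ _)[] : P a b by [].
  apply: interval_additive_ind => //; last first.
    move=> x y z ax xy yz zb Pxy Pyz _.
    have ay := le_trans ax xy; have yb := le_trans yz zb.
    have [Pxy1 Pxy2] := Pxy (And3 ax xy yb); have [Pyz1 Pyz2] := Pyz (And3 ay yz zb).
    have -> : I x z = (I x y + I y z)%E.
      have xzE : `]S x, S z]%classic = `]S x, S y] `|` `]S y, S z].
        by rewrite -itv_bndbnd_setU// bnd_simp Smono.
      rewrite /I xzE ge0_integral_setU//.
      - by rewrite -xzE; apply: mW => //; exact: le_trans yz.
      - by rewrite -xzE => u; apply: W0' => //; exact: le_trans yz.
      - apply/disj_set2P/seteqP; split => u //= []; rewrite !in_itv/=.
        by move=> /andP[_ uy] /andP[yu _]; have := lt_le_trans yu uy; rewrite ltxx.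
    rewrite (@metric_lengthD _ _ rho g x y z)//; last 2 first.
    - by move=> p q xp pq qz; apply: rho0g => //; [exact: le_trans xp | exact: le_trans zb].
    - by move=> p q r xp pq qr rz; apply: trig => //; [exact: le_trans xp | exact: le_trans zb].
    rewrite (_ : e * _ = e * (S y - S x) + e * (S z - S y)); last by ring.
    rewrite EFinD; split.
      by apply: (le_trans (leeD Pxy1 Pyz1)); rewrite addeACA.
    by apply: (le_trans (leeD Pxy2 Pyz2)); rewrite addeACA.
  move=> x ax xb.
  have [r [c1 [c2 [r0 c10 c12 H]]]] := dens _ (Dg x ax xb) e e0.
  have /within_continuousP/(_ x) := arclength_continuous rg.
  rewrite /= in_itv/= ax xb => /(_ isT r r0)[d d0 Hd].
  exists d => // s t as_ xs sx xt tx tb [_ st _].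
  have close p : s <= p -> p <= t -> euclid_dist (g x) (g p) < r.
    move=> sp pt; apply: le_lt_trans (arclength_dist_norm rg _ _) _;
      rewrite ?in_itv/= ?ax ?xb ?(le_trans as_ sp) ?(le_trans pt tb)//.
    apply: Hd; first by rewrite /= in_itv/= (le_trans as_ sp) (le_trans pt tb).
    by rewrite ltr_distlC; apply/andP; split; [exact: lt_le_trans sp| exact: le_lt_trans tx].
  have Dst p : s <= p -> p <= t -> D (g p).
    by move=> sp pt; apply: Dg; [exact: le_trans sp | exact: le_trans tb].
  (* All points of the path over [s, t] are close enough to [g x] for the
     constants [c1] and [c2] to apply. *)
  have Hst p q : s <= p -> p <= q -> q <= t -> _ :=
    fun sp pq qt => H _ _ (Dst p sp (le_trans pq qt)) (Dst q (le_trans sp pq) qt)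
      (close p sp (le_trans pq qt)) (close q (le_trans sp pq) qt).
  have lenE := arclengthB rg as_ st tb.
  have Dl0 : 0 <= S t - S s by rewrite subr_ge0 Smono.
  have c20 : 0 <= c2.
    by have [_ _ w1 w2] := Hst s s (lexx s) (lexx s) st; rewrite (le_trans c10)// (le_trans w1).
  have up : (metric_length rho s t g <= (c2 * (S t - S s))%:E)%E.
    rewrite EFinM -lenE; apply: metric_length_le_scale => // p q sp pq qt.
    by have [] := Hst p q sp pq qt.
  have down : ((c1 * (S t - S s))%:E <= metric_length rho s t g)%E.
    rewrite EFinM -lenE; apply: metric_length_ge_scale => //; first exact: rho0g.
    move=> p q sp pq qt; by have [] := Hst p q sp pq qt.
  have Wst u : `]S s, S t]%classic u -> c1 <= W u /\ W u <= c2.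
    rewrite /= in_itv/= => /andP[/ltW su ut].
    have [p /andP[sp pt] <-] := arclength_onto rg as_ st tb su ut.
    rewrite /W arclength_paramE//; last first.
      by rewrite in_itv/= (le_trans as_ sp) (le_trans pt tb).
    by have [] := Hst p p sp (lexx p) pt.
  have intc c : (\int[@lebesgue_measure R]_(u in `]S s, S t]) (cst c%:E u)
      = (c * (S t - S s))%:E)%E.
    rewrite integral_cst//= lebesgue_measure_itv/= lte_fin.
    have [_|] := ltP (S s) (S t); first by rewrite -EFinB -EFinM.
    by rewrite -subr_le0 => Dl; rewrite (_ : S t - S s = 0) ?mulr0 ?mule0//;
      apply/eqP; rewrite eq_le Dl.
  have Iup : (I s t <= (c2 * (S t - S s))%:E)%E.
    rewrite -intc; apply: ge0_le_integral => //.
    - by move=> u; exact: W0'.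
    - exact: mW.
    - by move=> u /Wst[_]; rewrite lee_fin.
  have Idown : ((c1 * (S t - S s))%:E <= I s t)%E.
    rewrite -intc; apply: ge0_le_integral => //.
    - exact: mW.
    - by move=> u /Wst[+ _]; rewrite lee_fin.
  have c2E : ((c2 * (S t - S s))%:E <= (c1 * (S t - S s))%:E + (e * (S t - S s))%:E)%E.
    by rewrite -EFinD lee_fin -mulrDl ler_wpM2r.
  split.
    by apply: le_trans up _; apply: le_trans c2E _; rewrite leeD2r.
  by apply: le_trans Iup _; apply: le_trans c2E _; rewrite leeD2r.
have Lpos : 0 <= S b - S a by rewrite subr_ge0 Smono.
have scale e : 0 < e -> 0 < e / (S b - S a + 1) /\
    e / (S b - S a + 1) * (S b - S a) <= e.
  move=> e0; have L1 : 0 < S b - S a + 1 by rewrite ltr_wpDl.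
  split; first exact: divr_gt0.
  by rewrite mulrAC ler_pdivrMr// ler_pM2l// lerDl.
apply/eqP; rewrite eq_le; apply/andP; split; apply/lee_addgt0Pr => e e0;
  have [e1 e2] := scale e e0; have [m1 m2] := main _ e1.
  by apply: le_trans m2 _; rewrite leeD2l// lee_fin.
by apply: le_trans m1 _; rewrite leeD2l// lee_fin.
Qed.

(** * Estimates for the quotient under the logarithm *)

(** [i_star] is twice the logarithm of this quotient, taken at
    p = eta x, q = eta y and t = d |x - y|; at t = 0 it is the quotient of the
    arithmetic and the geometric mean. *)
Definition mean_ratio (R : realType) (p q t : R) : R :=
  (p + q + t) / (2 * Num.sqrt (p * q)).

Lemma sqrtrM_ge (R : realType) (m p q : R) :
  0 <= m -> m <= p -> m <= q -> m <= Num.sqrt (p * q).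
Proof.
move=> m0 mp mq; rewrite -[leLHS]ger0_norm// -sqrtr_sqr ler_wsqrtr//.
by rewrite expr2 ler_pM.
Qed.

Lemma sqrtrM_le (R : realType) (m p q : R) :
  0 <= p -> 0 <= q -> p <= m -> q <= m -> Num.sqrt (p * q) <= m.
Proof.
move=> p0 q0 pm qm; have m0 := le_trans p0 pm.
rewrite -[leRHS]ger0_norm// -sqrtr_sqr ler_wsqrtr//.
by rewrite expr2 ler_pM.
Qed.

(** The inequality of the arithmetic and the geometric mean. *)
Lemma mean_ratio_ge (R : realType) (p q t : R) : 0 < p -> 0 < q ->
  1 + t / (2 * Num.sqrt (p * q)) <= mean_ratio p q t.
Proof.
move=> p0 q0; have s0 : 0 < Num.sqrt (p * q) by rewrite sqrtr_gt0 mulr_gt0.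
rewrite /mean_ratio [leRHS]mulrDl lerD2r ler_pdivlMr ?mulr_gt0// mul1r.
rewrite (sqrtrM _ (ltW p0)) -[X in _ <= X + _](sqr_sqrtr (ltW p0)).
rewrite -[X in _ <= _ + X](sqr_sqrtr (ltW q0)) -subr_ge0.
by rewrite (_ : _ - _ = (Num.sqrt p - Num.sqrt q) ^+ 2) ?sqr_ge0//; ring.
Qed.

(** The arithmetic mean exceeds the geometric mean by
    (sqrt p - sqrt q)^2 / 2 = (p - q)^2 / (2 (sqrt p + sqrt q)^2), and
    |p - q| <= t. *)
Lemma mean_ratio_le (R : realType) (p q t : R) : 0 < p -> 0 < q ->
  `|p - q| <= t ->
  mean_ratio p q t <= 1 + t / (2 * Num.sqrt (p * q))
    + t ^+ 2 / (2 * Num.sqrt (p * q) * (Num.sqrt p + Num.sqrt q) ^+ 2).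
Proof.
move=> p0 q0 pqt; rewrite /mean_ratio (sqrtrM _ (ltW p0)).
have u0 : 0 < Num.sqrt p by rewrite sqrtr_gt0.
have v0 : 0 < Num.sqrt q by rewrite sqrtr_gt0.
move: pqt; rewrite -{1 2}(sqr_sqrtr (ltW p0)) -{1 2}(sqr_sqrtr (ltW q0)).
set u := Num.sqrt p in u0 *; set v := Num.sqrt q in v0 * => uvt.
rewrite -subr_ge0 (_ : _ - _ = (t ^+ 2 - (u ^+ 2 - v ^+ 2) ^+ 2)
    / (2 * (u * v) * (u + v) ^+ 2)); last first.
  by field; rewrite !gt_eqF// addr_gt0.
apply: divr_ge0; last by rewrite mulr_ge0 ?sqr_ge0// !mulr_ge0// ltW.
rewrite subr_ge0 -[leLHS]real_normK ?num_real// ler_pXn2r// nnegrE.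
exact: le_trans uvt.
Qed.

Lemma mean_ratio_ge1 (R : realType) (p q t : R) : 0 < p -> 0 < q -> 0 <= t ->
  1 <= mean_ratio p q t.
Proof.
move=> p0 q0 t0; apply: le_trans (mean_ratio_ge t p0 q0).
by rewrite lerDl divr_ge0// mulr_ge0// sqrtr_ge0.
Qed.

(** The triangle inequality of [i_star] before taking logarithms. With
    t3 = t1 + t2, clearing denominators leaves
    (t1 - (q - p)) (t2 - (q - r)) >= 0, where both factors are nonnegative. *)
Lemma mean_ratio_submul (R : realType) (p q r t1 t2 t3 : R) :
  0 < p -> 0 < q -> 0 < r -> `|p - q| <= t1 -> `|q - r| <= t2 ->
  t3 <= t1 + t2 ->
  mean_ratio p r t3 <= mean_ratio p q t1 * mean_ratio q r t2.
Proof.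
move=> p0 q0 r0 pq qr t123; rewrite /mean_ratio.
have sq : Num.sqrt (p * q) * Num.sqrt (q * r) = q * Num.sqrt (p * r).
  rewrite !sqrtrM ?(ltW p0) ?(ltW q0)// -{3}(sqr_sqrtr (ltW q0)); ring.
have s0 : 0 < Num.sqrt (p * r) by rewrite sqrtr_gt0 mulr_gt0.
rewrite mulf_div mulrACA sq.
rewrite [leRHS](_ : _ = ((p + q + t1) * (q + r + t2) / (2 * q)) / (2 * Num.sqrt (p * r))); last first.
  by field; rewrite !gt_eqF.
rewrite ler_pM2r ?invr_gt0 ?mulr_gt0// ler_pdivlMr ?mulr_gt0//.
have prod : 0 <= (t1 - (q - p)) * (t2 - (q - r)).
  by rewrite mulr_ge0// subr_ge0; [rewrite (le_trans _ pq)// distrC ler_norm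
    |rewrite (le_trans _ qr)// ler_norm].
apply: (@le_trans _ _ ((p + r + (t1 + t2)) * (2 * q))).
  by rewrite ler_pM2r ?mulr_gt0// lerD2l.
rewrite -subr_ge0; apply: le_trans prod _.
by rewrite le_eqVlt; apply/orP; left; apply/eqP; ring.
Qed.

(** This is ln x <= x - 1 at x = 1 / (1 + a). *)
Lemma ln1D_ge (R : realType) (a : R) : 0 <= a -> a / (1 + a) <= ln (1 + a).
Proof.
move=> a0; have a1 : 0 < 1 + a by rewrite ltr_wpDr.
have -> : ln (1 + a) = - ln (1 + - (a / (1 + a))).
  rewrite (_ : 1 + - _ = (1 + a)^-1); last by field; rewrite gt_eqF.
  by rewrite lnV ?opprK.
rewrite lerNr le_ln1Dx// ltrN2 ltr_pdivrMr// mul1r.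
by rewrite ltrDr.
Qed.

(** The bounds [mean_ratio_ge] and [mean_ratio_le], linearized by
    a / (1 + a) <= ln (1 + a) <= a, when p and q are within the factor 1 +- k
    of H. The geometric mean of p and q is then also within this factor of H,
    and for k <= 1/2 the constants 2 k and 4 k absorb all terms of higher order
    in k. *)
Lemma two_ln_mean_ratio_bounds (R : realType) (d H k p q e : R) :
  0 < d -> 0 < H -> 0 <= k -> k <= 1 / 2 ->
  `|p - H| <= k * H -> `|q - H| <= k * H -> 0 <= e ->
  `|p - q| <= d * e -> d * e <= 2 * k * H ->
  (d / H * (1 - 2 * k)) * e <= 2 * ln (mean_ratio p q (d * e)) /\
  2 * ln (mean_ratio p q (d * e)) <= (d / H * (1 + 4 * k)) * e.
Proof.
move=> d0 H0 k0 k1 pH qH e0 pq te.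
have kH : k * H <= H / 2 by rewrite mulrC ler_pM2l// -div1r.
have /andP[pl pu] : (1 - k) * H <= p <= (1 + k) * H.
  by move: pH; rewrite ler_norml => /andP[? ?]; apply/andP; split; lra.
have /andP[ql qu] : (1 - k) * H <= q <= (1 + k) * H.
  by move: qH; rewrite ler_norml => /andP[? ?]; apply/andP; split; lra.
have m0 : 0 < (1 - k) * H by rewrite mulr_gt0//; lra.
have p0 := lt_le_trans m0 pl; have q0 := lt_le_trans m0 ql.
have sl : (1 - k) * H <= Num.sqrt (p * q) by rewrite sqrtrM_ge// ltW.
have su : Num.sqrt (p * q) <= (1 + k) * H by rewrite sqrtrM_le// ltW.
have s0 := lt_le_trans m0 sl.
have t0 : 0 <= d * e by rewrite mulr_ge0// ltW.
split.
  apply: (@le_trans _ _ (2 * ln (1 + d * e / (2 * Num.sqrt (p * q))))); last first.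
    rewrite ler_pM2l// ler_ln ?mean_ratio_ge// ?posrE.
      by rewrite ltr_wpDr// divr_ge0// mulr_ge0// ltW.
    exact: lt_le_trans (mean_ratio_ge1 p0 q0 t0).
  set s := Num.sqrt _ in sl su s0 *.
  apply: (@le_trans _ _ (2 * (d * e / (2 * s) / (1 + d * e / (2 * s))))); last first.
    by rewrite ler_pM2l// ln1D_ge// divr_ge0// mulr_ge0// ltW.
  rewrite [leRHS](_ : _ = d * e / (s + d * e / 2)); last first.
    field; rewrite !gt_eqF//; lra.
  rewrite ler_pdivlMr; last by lra.
  rewrite [leLHS](_ : _ = (d * e) * ((1 - 2 * k) * (s + d * e / 2) / H)); last first.
    by field; rewrite gt_eqF.
  rewrite ler_piMr// ler_pdivrMr// mul1r.
  apply: (@le_trans _ _ ((1 - 2 * k) * ((1 + 2 * k) * H))).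
    by rewrite ler_wpM2l//; lra.
  rewrite mulrA ler_piMl ?(ltW H0)//.
  by rewrite -subr_ge0 (_ : _ - _ = (2 * k) ^+ 2) ?sqr_ge0//; ring.
have u2 : 2 * H <= (Num.sqrt p + Num.sqrt q) ^+ 2.
  rewrite sqrrD !sqr_sqrtr ?(ltW p0) ?(ltW q0)// -(sqrtrM _ (ltW p0)); lra.
have U0 : 0 < (Num.sqrt p + Num.sqrt q) ^+ 2 by rewrite (lt_le_trans _ u2)// mulr_gt0.
have := mean_ratio_le p0 q0 pq.
set s := Num.sqrt (p * q) in sl su s0 *; set U := (_ + _) ^+ 2 in u2 U0 * => mr.
have b0 : 0 <= d * e / (2 * s) + (d * e) ^+ 2 / (2 * s * U).
  by rewrite addr_ge0// divr_ge0 ?sqr_ge0// ?mulr_ge0// ltW.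
apply: (@le_trans _ _ (2 * (d * e / (2 * s) + (d * e) ^+ 2 / (2 * s * U)))).
  rewrite ler_pM2l//; apply: le_trans (le_ln1Dx _); last by rewrite (lt_le_trans _ b0).
  rewrite ler_ln ?posrE ?addrA//.
    exact: lt_le_trans (mean_ratio_ge1 p0 q0 t0).
  by rewrite -addrA ltr_wpDr.
rewrite [leLHS](_ : _ = (d * e) * ((1 + d * e / U) / s)); last first.
  by field; rewrite !gt_eqF.
rewrite [leRHS](_ : _ = (d * e) * ((1 + 4 * k) / H)); last first.
  by field; rewrite gt_eqF.
rewrite ler_wpM2l// ler_pdivrMr// [leRHS]mulrAC ler_pdivlMr//.
have tU : d * e / U <= k.
  rewrite ler_pdivrMr//; apply: le_trans te _.
  by rewrite (mulrC 2) -mulrA ler_wpM2l.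
apply: (@le_trans _ _ ((1 + 4 * k) * ((1 - k) * H))); last first.
  by rewrite ler_wpM2l//; lra.
rewrite [leRHS]mulrA ler_pM2r//; apply: (@le_trans _ _ (1 + k)); first by lra.
rewrite -subr_ge0 (_ : _ - _ = 2 * k * (1 - 2 * k)); last by ring.
by rewrite !mulr_ge0//; lra.
Qed.

(** * The metric i_star and its inner metric *)

Lemma i_starE (R : realType) (n : nat) (D : set 'rV[R]_n) (x y : 'rV[R]_n) :
  i_star D x y = 2 * ln (mean_ratio (eta_dom D x) (eta_dom D y)
                           (diam_factor D * euclid_dist x y)).
Proof. by []. Qed.

Lemma i_star_ge0 (R : realType) (n : nat) (D : set 'rV[R]_n)
    (x y : 'rV[R]_n) : (2 <= n)%N -> domain D -> D <> setT -> D x -> D y ->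
  0 <= i_star D x y.
Proof.
move=> n2 hD DT Dx Dy; have [d0 eta0 _] := diam_factor_eta_dom n2 hD DT.
rewrite i_starE mulr_ge0// ln_ge0// mean_ratio_ge1 ?eta0//.
by rewrite mulr_ge0 ?euclid_dist_ge0// ltW.
Qed.

Lemma i_star_triangle (R : realType) (n : nat) (D : set 'rV[R]_n)
    (x y z : 'rV[R]_n) : (2 <= n)%N -> domain D -> D <> setT ->
  D x -> D y -> D z -> i_star D x z <= i_star D x y + i_star D y z.
Proof.
move=> n2 hD DT Dx Dy Dz; have [d0 eta0 lip] := diam_factor_eta_dom n2 hD DT.
have pos u v : D u -> D v -> 0 < mean_ratio (eta_dom D u) (eta_dom D v)
    (diam_factor D * euclid_dist u v).
  move=> Du Dv; apply: lt_le_trans ltr01 _; rewrite mean_ratio_ge1 ?eta0//.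
  by rewrite mulr_ge0 ?euclid_dist_ge0// ltW.
rewrite !i_starE -mulrDr ler_pM2l// -lnM ?posrE ?pos//.
rewrite ler_ln ?posrE; [|exact: pos|by apply: mulr_gt0; exact: pos].
apply: mean_ratio_submul; [exact: eta0..|exact: lip|exact: lip|].
by rewrite -mulrDr ler_pM2l// euclid_dist_triangle.
Qed.

(** The density is d / eta: both eta y and eta z are within the factor 1 +- k of
    eta x on the ball of radius k eta x / d, because eta is d-Lipschitz. *)
Lemma i_star_length_density (R : realType) (n : nat) (D : set 'rV[R]_n) :
  (2 <= n)%N -> domain D -> D <> setT ->
  length_density D (i_star D) (fun z => diam_factor D / eta_dom D z).
Proof.
move=> n2 hD DT x Dx e e0; have [d0 eta0 lip] := diam_factor_eta_dom n2 hD DT.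
set d := diam_factor D in d0 lip *; set H := eta_dom D x.
have H0 : 0 < H by exact: eta0.
have W0 : 0 < d / H by rewrite divr_gt0.
have W6 : 0 < 6 * (d / H) by rewrite mulr_gt0.
(* The interval [c1, c2] below has length 6 k d / H. *)
pose k := Num.min (1 / 2) (e / (6 * (d / H))).
have k0 : 0 < k by rewrite lt_min divr_gt0//= divr_gt0.
have k1 : k <= 1 / 2 by rewrite ge_min lexx.
have ke : 6 * k * (d / H) <= e.
  rewrite mulrAC mulrC -ler_pdivlMr//.
  by rewrite ge_min lexx orbT.
exists (k * H / d), (d / H * (1 - 2 * k)), (d / H * (1 + 4 * k)); split.
- by rewrite divr_gt0// mulr_gt0.
- by rewrite mulr_ge0//; [exact: ltW|lra].
- rewrite -lerBlDl; apply: le_trans ke.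
  by rewrite le_eqVlt; apply/orP; left; apply/eqP; ring.
move=> y z Dy Dz xy xz.
have near u : D u -> euclid_dist x u < k * H / d -> `|eta_dom D u - H| <= k * H.
  move=> Du; rewrite ltr_pdivlMr// mulrC => /ltW; apply: le_trans.
  by rewrite distrC lip.
have yH := near y Dy xy; have zH := near z Dz xz.
have yz : d * euclid_dist y z <= 2 * k * H.
  rewrite mulrC -ler_pdivlMr// (le_trans (euclid_dist_triangle y x z))//.
  rewrite (_ : 2 * k * H / d = k * H / d + k * H / d); last by ring.
  by rewrite (euclid_distC y) lerD// ltW.
have [lo hi] := two_ln_mean_ratio_bounds d0 H0 (ltW k0) k1 yH zH
  (euclid_dist_ge0 y z) (lip y z Dy Dz) yz.
have p0 := eta0 y Dy; move: yH; rewrite ler_norml => /andP[pl pu].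
split; [exact: lo|exact: hi| |].
- rewrite ler_pdivlMr// [leLHS](_ : _ = d * ((1 - 2 * k) * eta_dom D y / H)); last first.
    by field; rewrite gt_eqF.
  rewrite ler_piMr ?(ltW d0)// ler_pdivrMr// mul1r.
  apply: (@le_trans _ _ ((1 - 2 * k) * ((1 + k) * H))).
    by rewrite ler_wpM2l//; lra.
  rewrite mulrA ler_piMl ?(ltW H0)//.
  rewrite -subr_ge0 (_ : _ - _ = k * (1 + 2 * k)); last by ring.
  by rewrite mulr_ge0//; lra.
- rewrite ler_pdivrMr// [leRHS](_ : _ = d * ((1 + 4 * k) * eta_dom D y / H)); last first.
    by field; rewrite gt_eqF.
  rewrite ler_peMr ?(ltW d0)// ler_pdivlMr// mul1r.
  apply: (@le_trans _ _ ((1 + 4 * k) * ((1 - k) * H))); last first.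
    by rewrite ler_wpM2l//; lra.
  rewrite mulrA ler_peMl ?(ltW H0)//.
  rewrite -subr_ge0 (_ : _ - _ = k * (3 - 4 * k)); last by ring.
  by rewrite mulr_ge0//; lra.
Qed.

Lemma length_density_cvg (R : realType) (n : nat) (D : set 'rV[R]_n)
    (rho : 'rV[R]_n -> 'rV[R]_n -> R) (w : 'rV[R]_n -> R) (x : 'rV[R]_n) :
  length_density D rho w -> D x ->
  rho x y / euclid_dist x y @[y --> within D (dnbhs x)] --> w x.
Proof.
move=> dens Dx; apply/cvgrPdist_lt => e e0.
have e2 : 0 < e / 2 by rewrite divr_gt0.
have [r [c1 [c2 [r0 c10 c12 H]]]] := dens x Dx _ e2.
have xx : euclid_dist x x < r by rewrite euclid_distxx.
have near_x : \forall y \near x, euclid_dist x y < r by exact: nbhs_euclid_ball.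
rewrite near_withinE /dnbhs near_withinE.
apply: filterS near_x => y xy yx Dy.
have [lo hi w1 w2] := H x y Dx Dy xx xy.
have exy : 0 < euclid_dist x y.
  rewrite lt0r euclid_dist_ge0 andbT; apply: contra yx => /eqP/euclid_dist_eq0 ->.
  by [].
have : c1 <= rho x y / euclid_dist x y by rewrite ler_pdivlMr.
have : rho x y / euclid_dist x y <= c2 by rewrite ler_pdivrMr.
by move=> ? ?; rewrite ltr_norml; apply/andP; split; lra.
Qed.

Theorem proposition3p9 (R : realType) (n : nat) (D : set 'rV[R]_n)
    (hn : (2 <= n)%N) (hD : domain D) (hDT : D <> setT) :
  [/\ forall x y, D x -> D y ->
        2 * ln (1 + diam_factor D * euclid_dist x y
                    / (2 * Num.sqrt (eta_dom D x * eta_dom D y)))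
          <= i_star D x y
        /\ i_star D x y <=
        2 * ln (1 + diam_factor D * euclid_dist x y
                    / (2 * Num.sqrt (eta_dom D x * eta_dom D y))
                  + diam_factor D ^+ 2 * euclid_dist x y ^+ 2
                    / (2 * Num.sqrt (eta_dom D x * eta_dom D y)
                       * (Num.sqrt (eta_dom D x) + Num.sqrt (eta_dom D y)) ^+ 2)),
      forall x, D x ->
        i_star D x y / euclid_dist x y @[y --> within D (dnbhs x)]
          --> diam_factor D / eta_dom D x
    & forall x y, D x -> D y ->
        m_metric D x y = inner_metric D (i_star D) x y].
Proof.
have [d0 eta0 lip] := diam_factor_eta_dom hn hD hDT.
have dens := i_star_length_density hn hD hDT.
split=> [x y Dx Dy|x Dx|x y Dx Dy].
- have p0 := eta0 x Dx; have q0 := eta0 y Dy; have pq := lip x y Dx Dy.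
  have t0 : 0 <= diam_factor D * euclid_dist x y.
    exact: le_trans (normr_ge0 _) pq.
  have s0 : 0 < Num.sqrt (eta_dom D x * eta_dom D y) by rewrite sqrtr_gt0 mulr_gt0.
  have m1 := lt_le_trans ltr01 (mean_ratio_ge1 p0 q0 t0).
  have a1 : 0 < 1 + diam_factor D * euclid_dist x y
                    / (2 * Num.sqrt (eta_dom D x * eta_dom D y)).
    by rewrite ltr_wpDr// divr_ge0// mulr_ge0// ltW.
  have up := mean_ratio_le p0 q0 pq.
  rewrite i_starE -exprMn; split; rewrite ler_pM2l// ler_ln ?posrE//.
    exact: mean_ratio_ge.
  exact: lt_le_trans up.
- exact: length_density_cvg dens Dx.
(* The two lengths agree path by path, so the infima are taken over the same
   set. *)
- rewrite /m_metric /inner_metric; congr ereal_inf; apply/seteqP.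
  have lenE a b g : rectifiable_path_in D x y a b g ->
      line_integral (fun z => diam_factor D / eta_dom D z) a b g
      = metric_length (i_star D) a b g.
    move=> [rg gD _ _]; apply: line_integral_metric_length dens rg gD.
      by move=> u v; exact: i_star_ge0.
    by move=> u v z; exact: i_star_triangle.
  by split=> _ [a [b [g [pg ->]]]]; exists a, b, g; rewrite lenE.
Qed.
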